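(* For every positive integer $k$ and every $n$, every $4$-uniform hypergraph on $n$ vertices containing no Berge copy of the path $P_k$ with $k$ edges has strong chromatic number at most $k+11$; that is, $\mathrm{schex}_4(n,\mathcal{B}(P_k))\le k+11$.
   Context: For a graph $F$, a hypergraph $\mathcal{H}$ is a Berge-$F$ if there is a bijection $f:E(F)\to E(\mathcal{H})$ with $e\subseteq f(e)$ for every $e\in E(F)$; $\mathcal{B}(F)$ is the family of Berge-$F$ hypergraphs. A hypergraph contains a Berge copy of $F$ if it has a subhypergraph in $\mathcal{B}(F)$. $\mathrm{schex}_4(n,\mathcal{B}(F))$ is the supremum of the strong chromatic number (minimum number of colors in a vertex coloring in which each hyperedge is rainbow) over $\mathcal{B}(F)$-free $4$-uniform hypergraphs on $n$ vertices. *)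

(* Defs.v *)
From mathcomp Require Import all_boot.
Set Implicit Arguments.
Unset Strict Implicit.
Unset Printing Implicit Defensive.

(* A hypergraph on the vertex set [T] is given by its set of hyperedges; a
   graph is a 2-uniform hypergraph. *)
Notation hypergraph T := {set {set T}}.

Section Hypergraphs.
Variable T : finType.
Implicit Type H : hypergraph T.

Definition uniform (r : nat) H : bool := [forall e in H, #|e| == r].

Definition strong_coloring (q : nat) H (c : {ffun T -> 'I_q}) : bool :=
  [forall e in H, dinjectiveb c (mem e)].

Definition strong_colorable H (q : nat) : bool :=
  [exists c : {ffun T -> 'I_q}, strong_coloring H c].

Lemma strong_colorable_ex H : exists q, strong_colorable H q.
Proof.
exists #|T|; apply/existsP; exists [ffun x => enum_rank x].
apply/forall_inP=> e _; apply/dinjectiveP=> x y _ _.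
by rewrite !ffunE; apply: enum_rank_inj.
Qed.

Definition strong_chromatic_number H : nat := ex_minn (strong_colorable_ex H).

Variable V : finType.
Implicit Type F : hypergraph V.

(* [phi] realises the vertices of F as vertices of the hypergraph, so that the
   inclusion of an edge of F in a hyperedge makes sense; [f] restricts to a
   bijection from the edges of F onto the hyperedges of H. *)
Definition is_berge F H : bool :=
  [exists phi : {ffun V -> T}, exists f : {ffun {set V} -> {set T}},
    [&& injectiveb phi, dinjectiveb f (mem F), f @: F == H
      & [forall e in F, phi @: e \subset f e]]].

Definition has_berge_copy F H : bool :=
  [exists H' : hypergraph T, (H' \subset H) && is_berge F H'].

Definition berge_free F H : bool := ~~ has_berge_copy F H.

End Hypergraphs.

(* The maximum ranges over a finite set; it is nonempty as soon as F has an
   edge. *)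
Definition schex (r n : nat) (V : finType) (F : hypergraph V) : nat :=
  \max_(H : hypergraph 'I_n | uniform r H && berge_free F H)
     strong_chromatic_number H.

(* The path with k edges {i, i+1}, i < k, on the k+1 vertices 0, ..., k. *)
Definition path_graph (k : nat) : hypergraph 'I_k.+1 :=
  [set [set widen_ord (leqnSn k) i; lift ord0 i] | i : 'I_k].

(* Main.v *)
Require Import Defs.
From mathcomp Require Import all_boot.
From mathcomp Require Import zify.

(** If the strong chromatic number exceeds [k + 11], some nonempty vertex set
    [U] is such that every vertex of [U] shares a hyperedge with at least
    [k + 11] other vertices of [U].  Take a longest Berge path
    [v_0 e_0 v_1 ... e_(m-1) v_m] with all [v_i] in [U], and suppose [m < k].
    Let [Z] be the set of the [i] for which some hyperedge [f], either [e_i]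
    itself or not on the path, contains both [v_i] and [v_m]; reversing the
    part of the path after [v_i] then gives a longest path with end
    [v_(i+1)].  Every neighbour of [v_m] lies in [e_i :\ v_m] or equals [v_i]
    for some [i] in [Z], so [k + 11 <= 3 |Z|].  On the other hand, each of the
    new ends has at least 12 neighbours off the path, which are all reached
    through hyperedges of the original path.  As a hyperedge with [a] vertices
    on and [b] vertices off the path satisfies [a b <= 4], double counting
    gives [12 |Z| <= 4 m], a contradiction. *)

Set Implicit Arguments.
Unset Strict Implicit.
Unset Printing Implicit Defensive.

(** * Greedy colouring *)

Section DegenerateColoring.

Variables (T : finType) (adj : rel T) (q : nat).
Hypothesis adj_sym : symmetric adj.

(** Greedy colouring: remove a vertex [x] of small degree and colour the rest by induction; the
    fewer than [q] neighbours of [x] leave a colour free for it. *)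
Lemma degenerate_coloring (U : {set T}) :
  0 < q ->
  (forall W : {set T}, W != set0 ->
     exists2 x, x \in W & #|[set y in W | (y != x) && adj x y]| < q) ->
  exists c : {ffun T -> 'I_q},
    {in U &, forall x y, x != y -> adj x y -> c x != c y}.
Proof.
move=> q0 degW; have [n] := ubnP #|U|; elim: n U => // n IHn U ltUn.
have [->|/degW[x xU ltx]] := eqVneq U set0.
  by exists [ffun=> Ordinal q0] => x y; rewrite inE.
have [|c cP] := IHn (U :\ x); first by move: ltUn; rewrite (cardsD1 x) xU.
set N := [set y in U | _] in ltx.
have [a aN] : exists a, a \notin c @: N.
  apply/existsP; rewrite -negb_forall; apply/negP => /forallP allN.
  have := leq_ltn_trans (leq_imset_card c N) ltx.
  suff -> : c @: N = [set: 'I_q] by rewrite cardsT card_ord ltnn.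
  by apply/setP=> a; rewrite inE allN.
have aP y : y \in U -> y != x -> adj x y -> a != c y.
  move=> yU yx xy; apply: contraNneq aN => ->.
  by apply: imset_f; rewrite inE yU yx.
exists [ffun y => if y == x then a else c y] => y z yU zU.
rewrite !ffunE; have [->|yx] := eqVneq y x.
  by rewrite eq_sym => zx; rewrite (negPf zx); apply: aP.
have [->|zx] := eqVneq z x.
  by move=> _; rewrite adj_sym eq_sym; apply: aP.
by apply: cP; rewrite !inE ?yx ?zx.
Qed.

End DegenerateColoring.

Section BergePaths.

Variable T : finType.
Implicit Types (H : hypergraph T) (U : {set T}) (s : seq T).
Implicit Types (es : seq {set T}) (x y z w : T) (e f : {set T}).

(** * Vertex sets of large minimum degree *)

Definition coadjacent H x y := [exists e in H, (x \in e) && (y \in e)].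

Lemma coadjacent_sym H : symmetric (coadjacent H).
Proof. by move=> x y; apply: eq_existsb => e; rewrite [(x \in e) && _]andbC. Qed.

Definition neighbours H U x := [set y in U | (y != x) && coadjacent H x y].

(** If no such [U] exists, greedy colouring with [q] colours separates all coadjacent vertices,
    which makes every hyperedge rainbow. *)
Lemma strong_chromatic_number_core H q :
  0 < q < strong_chromatic_number H ->
  exists2 U, U != set0 & {in U, forall x, q <= #|neighbours H U x|}.
Proof.
case/andP=> q0; rewrite /strong_chromatic_number.
case: ex_minnP => chi _ chi_min lt_q.
have [/existsP[U /andP[U0 /forall_inP]]|noU] :=
  boolP [exists U : {set T}, (U != set0)
          && [forall x in U, q <= #|neighbours H U x|]]; first by exists U.
suff: strong_colorable H q by move/chi_min; rewrite leqNgt lt_q.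
have [|c cP] :=
  @degenerate_coloring _ _ q (@coadjacent_sym H) [set: T] q0.
  move=> W W0; move: noU; rewrite negb_exists => /forallP/(_ W).
  rewrite W0 negb_forall_in => /exists_inP[x xW]; rewrite -ltnNge.
  by exists x.
apply/existsP; exists c; apply/forall_inP=> e eH.
apply/dinjectiveP=> x y xe ye; apply: contra_eq => xy.
apply: cP; rewrite ?inE //.
by apply/exists_inP; exists e => //; rewrite xe.
Qed.

(** * Berge walks and paths *)

Fixpoint berge_walk s es :=
  match s, es with
  | [:: _], [::] => true
  | x :: (y :: _) as s', e :: es' => [&& x \in e, y \in e & berge_walk s' es']
  | _, _ => false
  end.

Lemma size_berge_walk s es : berge_walk s es -> size s = (size es).+1.
Proof.
elim: s es => [|x [|y s] IHs] [|e es] //= /and3P[_ _ /IHs].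
by move=> /= ->.
Qed.

Lemma berge_walk_cat s1 x y s2 es1 e es2 :
  size es1 = size s1 ->
  berge_walk (s1 ++ x :: y :: s2) (es1 ++ e :: es2) =
  [&& berge_walk (rcons s1 x) es1, x \in e, y \in e
    & berge_walk (y :: s2) es2].
Proof.
elim: s1 es1 => [|a s1 IHs] [|d es1] //= [eq_sz].
have {IHs} := IHs es1 eq_sz; case: s1 eq_sz => [|b s1] eq_sz IHs.
  by rewrite /= in IHs *; rewrite IHs -!andbA.
by rewrite /= in IHs *; rewrite IHs -!andbA.
Qed.

Lemma berge_walk_rev s es : berge_walk (rev s) (rev es) = berge_walk s es.
Proof.
have [eq_sz|ne_sz] := eqVneq (size s) (size es).+1; last first.
  apply/idP/idP => /size_berge_walk; rewrite ?size_rev => eq_sz;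
  by rewrite eq_sz eqxx in ne_sz.
elim: s es eq_sz => [|x [|y s] IHs] [|e es] //= [eq_sz].
rewrite [rev (x :: _)]rev_cons [rev (y :: _)]rev_cons [rev (e :: _)]rev_cons.
rewrite -!cats1 -catA /= berge_walk_cat ?size_rev //.
rewrite -rev_cons IHs /= ?eq_sz // andbT.
by rewrite andbC -andbA andbCA.
Qed.

Lemma berge_walk_nth x0 s es i :
  berge_walk s es -> i < size es ->
  (nth x0 s i \in nth set0 es i) && (nth x0 s i.+1 \in nth set0 es i).
Proof.
elim: s es i => [|x [|y s] IHs] [|e es] //= [|i] /and3P[xe ye wse] //=.
  by rewrite xe ye.
exact: IHs.
Qed.

Definition berge_path H U s es :=
  [&& berge_walk s es, uniq s, uniq es, all [in U] s & all [in H] es].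

Lemma berge_path_rcons H U s z w es e :
  berge_path H U (rcons s z) es -> w \in U -> w \notin rcons s z ->
  e \in H -> e \notin es -> z \in e -> w \in e ->
  berge_path H U (rcons (rcons s z) w) (rcons es e).
Proof.
case/and5P=> walk us ues sU esH wU ws eH ees ze we.
have eq_sz := size_berge_walk walk; rewrite size_rcons in eq_sz.
apply/and5P; split.
- rewrite -!cats1 -catA /= berge_walk_cat; last by case: eq_sz.
  by rewrite walk ze we.
- by rewrite rcons_uniq ws.
- by rewrite rcons_uniq ees.
- by rewrite all_rcons /= wU.
- by rewrite all_rcons /= eH.
Qed.

(** Pósa rotation: from [y], jump through [f] to the last vertex and run backwards to [z], the new
    end. The hyperedge [e] is dropped, so [f] may be [e] itself. *)
Lemma berge_path_rotate H U s1 y z s2 es1 e es2 f :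
  let s := s1 ++ y :: z :: s2 in let es := es1 ++ e :: es2 in
  size es1 = size s1 -> berge_path H U s es ->
  f \in H -> y \in f -> last z s2 \in f -> (f \notin es) || (f == e) ->
  berge_path H U (s1 ++ y :: rev (z :: s2)) (es1 ++ f :: rev es2).
Proof.
move=> s es eq_sz /and5P[walk us ues sU esH] fH yf lf fes.
move: walk; rewrite berge_walk_cat // => /and4P[walk1 _ _ walk2].
have perm_es : perm_eq (e :: es1 ++ es2) es.
  exact: (permEl (perm_catCA [:: e] es1 es2)).
have perm_s : perm_eq (s1 ++ y :: rev (z :: s2)) s.
  by rewrite perm_cat2l perm_cons perm_rev.
have perm_es' : perm_eq (es1 ++ f :: rev es2) (f :: es1 ++ es2).
  apply: perm_trans (permEl (perm_catCA es1 [:: f] (rev es2))) _.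
  by rewrite perm_cons perm_cat2l perm_rev.
have := ues; rewrite -(perm_uniq perm_es) => /andP[ee ues'].
have := esH; rewrite -(perm_all _ perm_es) => /andP[_ esH'].
have fes' : f \notin es1 ++ es2.
  case/orP: fes => [|/eqP-> //].
  by rewrite -(perm_mem perm_es) inE negb_or => /andP[].
apply/and5P; split.
- have := walk2; rewrite -berge_walk_rev lastI rev_rcons => walk2'.
  by rewrite berge_walk_cat // walk1 yf lf.
- by rewrite (perm_uniq perm_s).
- by rewrite (perm_uniq perm_es') /= fes'.
- by rewrite (perm_all _ perm_s).
- by rewrite (perm_all _ perm_es') /= fH.
Qed.

Lemma berge_path_has_copy H U s es k :
  berge_path H U s es -> k <= size es -> has_berge_copy (path_graph k) H.
Proof.
case/and5P=> walk us ues _ /allP esH le_k.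
have sz := size_berge_walk walk.
have [x0 _] : exists x0 : T, true by case: s sz {walk us} => // x; exists x.
pose edge (i : 'I_k) := [set widen_ord (leqnSn k) i; lift ord0 i].
have edge_inj : injective edge.
  move=> i j /setP eq_ij; apply/val_inj; rewrite /=.
  (* Comparing the two edges at their lower ends [i] and [j] already forces [i = j]. *)
  have := eq_ij (widen_ord (leqnSn k) i); have := eq_ij (widen_ord (leqnSn k) j).
  rewrite !inE -!val_eqE /= /bump /=; lia.
pose phi := [ffun i : 'I_k.+1 => nth x0 s i].
(* The default [set0] is taken only at sets that are not edges of the path graph. *)
pose f : {ffun {set 'I_k.+1} -> {set T}} := [ffun d =>
  if [pick i | d == edge i] is Some i then nth set0 es i else set0].
have fE i : f (edge i) = nth set0 es i.
  rewrite ffunE; case: pickP => [j /eqP/edge_inj-> //|/(_ i)].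
  by rewrite eqxx.
have lt_es (i : 'I_k) : i < size es by apply: leq_trans le_k.
apply/existsP; exists (f @: path_graph k); apply/andP; split.
  apply/subsetP=> _ /imsetP[_ /imsetP[i _ ->] ->].
  by rewrite fE; apply/esH/mem_nth.
apply/existsP; exists phi; apply/existsP; exists f; apply/and4P; split=> //.
- apply/injectiveP=> i j; rewrite !ffunE => /eqP.
  have lt_s (l : 'I_k.+1) : l < size s.
    by rewrite sz ltnS; apply: leq_trans le_k; rewrite -ltnS.
  by rewrite nth_uniq // => /eqP/val_inj.
- apply/dinjectiveP=> _ _ /imsetP[i _ ->] /imsetP[j _ ->].
  by rewrite !fE => /eqP; rewrite nth_uniq // => /eqP/val_inj->.
- apply/forall_inP=> _ /imsetP[i _ ->]; rewrite fE.
  have /andP[ie iSe] := berge_walk_nth x0 walk (lt_es i).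
  apply/subsetP=> _ /imsetP[j ij ->]; rewrite ffunE.
  by move: ij; rewrite !inE => /orP[] /eqP->.
Qed.

(** * Length of a longest Berge path *)

Lemma leq_card_bigcup (I : finType) (Q : pred I) (F : I -> {set T}) :
  #|\bigcup_(i | Q i) F i| <= \sum_(i | Q i) #|F i|.
Proof.
elim/big_rec2: _ => [|i n X _ leX]; first by rewrite cards0.
by rewrite (leq_trans (leq_card_setU _ _)) // leq_add2l.
Qed.

Lemma longest_berge_path_length H U s es k :
  uniform 4 H -> {in U, forall x, k + 11 <= #|neighbours H U x|} ->
  berge_path H U s es ->
  (forall s' es', size es' = (size es).+1 -> ~~ berge_path H U s' es') ->
  k <= size es.
Proof.
move=> /forall_inP H4 degU pathP longest; rewrite leqNgt; apply/negP=> lt_mk.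
have /and5P[walk us ues /allP sU /allP esH] := pathP.
have sz := size_berge_walk walk; set m := size es in lt_mk sz.
case/lastP: s walk us sU sz pathP => [//|s x] walk us sU sz pathP.
set v := nth x (rcons s x); pose e := nth set0 es.
have vP i : i <= m -> v i \in rcons s x by move=> le_i; rewrite mem_nth ?sz.
have eP i : i < m -> e i \in es by move=> lt_i; rewrite mem_nth.
have veP i : i < m -> (v i \in e i) && (v i.+1 \in e i).
  exact: berge_walk_nth.
have vm : v m = x.
  by move: sz; rewrite size_rcons /v nth_rcons => -[<-]; rewrite ltnn eqxx.
have card_e i : i < m -> #|e i| = 4 by move=> /eP/esH/H4/eqP.
pose P := [set y in rcons s x]; pose O := U :\: P.
have cardP : #|P| = m.+1 by rewrite cardsE (card_uniqP us).
(* Otherwise [f] and [w] would extend the path. Any path of length [m] on the vertex set [P] is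
   allowed, so that rotated paths are covered. *)
have stuck s1 z es1 f w : berge_path H U (rcons s1 z) es1 ->
    size es1 = m -> rcons s1 z =i P ->
    f \in H -> z \in f -> w \in f -> w \in O -> f \in es1.
  move=> path1 sz1 eqP fH zf wf /setDP[wU wP].
  apply: contraTT isT => fes1.
  have := longest (rcons (rcons s1 z) w) (rcons es1 f).
  rewrite size_rcons sz1 => /(_ erefl)/negP[].
  by apply: (berge_path_rcons path1); rewrite // eqP.
have stuck_x f w :
    f \in H -> x \in f -> w \in f -> w \in O -> f \in es.
  by apply: (stuck s); rewrite // => y; rewrite inE.
pose Z := [set i : 'I_m | [exists f in H,
  [&& v i \in f, x \in f & (f \notin es) || (f == e i)]]].
have leZ : k + 11 <= #|Z| * 3.
  have xU : x \in U by apply: sU; rewrite mem_rcons mem_head.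
  apply: leq_trans (degU x xU) _.
  (* A neighbour of [x] through [e i] lies in [e i :\ x]; one through a hyperedge off the path is
     some [v i] by [stuck_x], and [v i] is in [M i] in both cases. *)
  pose M i := if x \in e i then e i :\ x else [set v i].
  have cardM (i : 'I_m) : #|M i| <= 3.
    rewrite /M; case: ifP => [xe|_]; last by rewrite cards1.
    by have := card_e i (ltn_ord i); rewrite (cardsD1 x) xe add1n => -[->].
  apply: leq_trans (_ : #|\bigcup_(i in Z) M i| <= _); last first.
    apply: leq_trans (leq_card_bigcup _ _) _.
    by rewrite -sum_nat_const leq_sum.
  apply/subset_leq_card/subsetP=> y; rewrite inE => /and3P[yU yx].
  case/exists_inP=> f fH /andP[xf yf].
  have [fes|fes] := boolP (f \in es).
    have lt_i : index f es < m by rewrite index_mem.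
    have ei : e (index f es) = f by rewrite /e nth_index.
    apply/bigcupP; exists (Ordinal lt_i); last by rewrite /M /= ei xf !inE yx.
    rewrite inE; apply/exists_inP; exists f => //=.
    by have /andP[] := veP _ lt_i; rewrite ei => -> _; rewrite xf eqxx orbT.
  have yP : y \in rcons s x.
    apply: contraNT fes => ys.
    by apply: (stuck_x _ _ fH xf yf); rewrite !inE ys.
  have vi : v (index y (rcons s x)) = y by rewrite /v nth_index.
  have lt_i : index y (rcons s x) < m.
    have := yP; rewrite -index_mem sz ltnS leq_eqVlt => /orP[/eqP eq_i|//].
    by rewrite -vi eq_i vm eqxx in yx.
  apply/bigcupP; exists (Ordinal lt_i).
    by rewrite inE; apply/exists_inP; exists f => //=; rewrite vi yf xf fes.
  rewrite /M /= vi; case: ifP; last by rewrite inE.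
  by rewrite !inE yx; have /andP[] := veP _ lt_i; rewrite vi.
have leO (i : 'I_m) :
    i \in Z -> 12 <= \sum_(j < m | v i.+1 \in e j) #|e j :&: O|.
  rewrite inE => /exists_inP[f fH /and3P[vf xf fes]].
  set z := v i.+1; have zs : z \in rcons s x by apply: vP.
  have nbO : neighbours H U z :\: P
               \subset \bigcup_(j < m | z \in e j) (e j :&: O).
    apply/subsetP=> w; rewrite !inE => /andP[wP /and3P[wU wz]].
    case/exists_inP=> g gH /andP[zg wg].
    have wO : w \in O by rewrite !inE wP.
    suff ges : g \in es.
      have lt_j : index g es < m by rewrite index_mem.
      have ej : e (index g es) = g by rewrite /e nth_index.
      by apply/bigcupP; exists (Ordinal lt_j); rewrite /= ej // inE wg.
    (* Rotating at [v i] gives a path with end [z] and the same length and vertices, to which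
       [stuck] applies. *)
    have lt_i := ltn_ord i.
    have def_s : rcons s x = take i (rcons s x) ++ v i :: z :: drop i.+2 (rcons s x).
      by rewrite -!drop_nth ?sz ?cat_take_drop // ltnS // ltnW.
    have def_es : es = take i es ++ e i :: drop i.+1 es.
      by rewrite -drop_nth ?cat_take_drop.
    have lastE : last z (drop i.+2 (rcons s x)) = x.
      by have := last_rcons x s x; rewrite {1}def_s last_cat.
    have sz1 : size (take i es) = size (take i (rcons s x)).
      by rewrite !size_take sz lt_i ltnS (ltnW lt_i).
    have path' := pathP; rewrite def_s def_es in path'.
    have {path'} := berge_path_rotate sz1 path' fH vf.
    rewrite lastE -def_es => /(_ xf fes).
    rewrite rev_cons -rcons_cons -rcons_cat => rpath.
    have ges' : g \in take i es ++ f :: rev (drop i.+1 es).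
      apply: stuck rpath _ _ gH zg wg wO.
        by rewrite [in RHS]/m [in RHS]def_es !size_cat /= size_rev.
      move=> y; rewrite inE [in RHS]def_s.
      by rewrite rcons_cat rcons_cons -rev_cons !mem_cat !inE mem_rev inE.
    (* Only [f] can be new on the rotated path; but [f] contains [x], so if it met [O] outside [es]
       the original path would extend. *)
    have [gf|ngf] := eqVneq g f.
      by apply: (stuck_x _ w); rewrite // gf // -gf.
    rewrite def_es; move: ges'.
    rewrite !mem_cat !inE (negPf ngf) mem_rev /= => /orP[->//|->].
    by rewrite !orbT.
  apply: leq_trans (leq_card_bigcup _ _).
  apply: leq_trans (subset_leq_card nbO).
  (* As [z] is not its own neighbour, at most [m < k] of its [k + 11] neighbours are on the path,
     leaving 12. *)
  have leP : #|neighbours H U z :&: P| <= m.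
    have := cardP; rewrite (cardsD1 z) inE zs add1n => -[<-].
    apply/subset_leq_card/subsetP=> y; rewrite !inE.
    by case/andP=> /and3P[_ -> _].
  have := degU z (sU _ zs); rewrite cardsD; lia.
have le4 : \sum_(i in Z) \sum_(j < m | v i.+1 \in e j) #|e j :&: O| <= m * 4.
  rewrite (exchange_big_dep predT) //= -[m in m * 4]card_ord -sum_nat_const.
  apply: leq_sum => j _; rewrite sum_nat_const.
  have cardZ : #|[pred i in Z | v i.+1 \in e j]| <= #|e j :&: P|.
    have v_inj : {in [pred i in Z | v i.+1 \in e j] &,
                   injective (fun i : 'I_m => v i.+1)}.
      move=> i1 i2 _ _ /eqP; rewrite nth_uniq ?sz ?ltnS //.
      by rewrite eqSS => /eqP/val_inj.
    rewrite -(card_in_imset v_inj).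
    apply/subset_leq_card/subsetP=> _ /imsetP[i /andP[_ vi] ->].
    by rewrite in_setI vi inE vP.
  have cardO : #|e j :&: P| + #|e j :&: O| <= 4.
    rewrite -(card_e j) // -(cardsID P (e j)) leq_add2l.
    by apply: subset_leq_card; rewrite setDE setIS // /O setDE subsetIr.
  apply: leq_trans (leq_mul cardZ (leqnn _)) _.
  (* The factor 4 prepares for [4ab <= (a + b)^2], here at most [4^2]. *)
  rewrite -(leq_pmul2l (isT : 0 < 4)).
  by apply: leq_trans (nat_AGM2 _ _).1 _; rewrite (@leq_sqr _ 4).
have : \sum_(i in Z) 12 <= m * 4 by apply: leq_trans le4; apply: leq_sum.
(* Now [3 |Z| <= m < k], against [leZ]. *)
rewrite sum_nat_const; lia.
Qed.

(** * The chromatic bound *)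

Lemma strong_chromatic_number_berge_path_free H k :
  uniform 4 H -> berge_free (path_graph k) H ->
  strong_chromatic_number H <= k + 11.
Proof.
move=> H4 /negP free; rewrite leqNgt; apply/negP => lt_chi.
have [|U /set0Pn[x xU] degU] := @strong_chromatic_number_core H (k + 11).
  by rewrite lt_chi addnS.
(* If no path has [m + 1 <= k] hyperedges, then none has [m], since such a path could not be
   lengthened and would have at least [k]. This descends to length 0, where the single vertex [x] is
   a path. *)
suff noU m : m <= k -> ~ (forall s es, size es = m -> ~~ berge_path H U s es).
  apply: (noU k) => // s es sz; apply/negP => /berge_path_has_copy cp.
  by apply: free; apply: cp; rewrite sz.
elim: m => [_|m IHm lt_mk] no_path.
  by have := no_path [:: x] [::] erefl; rewrite /berge_path /= xU.
apply: IHm => [|s es sz]; first exact: ltnW.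
apply/negP => pathP.
have := longest_berge_path_length H4 degU pathP.
by rewrite sz leqNgt lt_mk => /(_ no_path).
Qed.

End BergePaths.

Theorem theorem1p8 (k n : nat) (hk : 0 < k) :
  (forall (T : finType) (H : hypergraph T),
      #|T| = n -> uniform 4 H -> berge_free (path_graph k) H ->
      strong_chromatic_number H <= k + 11)
  /\ schex 4 n (path_graph k) <= k + 11.
Proof.
split=> [T H _|]; first exact: strong_chromatic_number_berge_path_free.
by apply/bigmax_leqP=> H /andP[]; apply: strong_chromatic_number_berge_path_free.
Qed.
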